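(* For every $p\in(1,\infty)$ and every $\varepsilon>0$ (with additionally $\varepsilon<p-1$ if $p\in(1,2)$) there exists a positive constant $c(p,\varepsilon)$, depending only on $p$ and $\varepsilon$, such that the following holds for every positive integer $n$, every $d\in[n]$, every $f\in\mathrm{Tail}_{\ge d}$ and every $t>0$. (i) If $\theta=\theta(p,\varepsilon)$ satisfies $$\frac1p=\frac{\theta}{p_\varepsilon}+\frac{1-\theta}{2},$$ then $$\|e^{-t\Delta}f\|_{L^p(\{-1,1\}^n)}\le \exp(-c(p,\varepsilon)\,td)\,\|f\|_{L^2(\{-1,1\}^n)}^{1-\theta}\,\|f\|_{L^{p_\varepsilon}(\{-1,1\}^n)}^{\theta}.$$ (ii) If $p\in[2,\infty)$, then also $$\|e^{-t\Delta}f\|_{L^p(\{-1,1\}^n)}\le \exp(-c(p,\varepsilon)\,td)\,\|f\|_{L^{p+\varepsilon}(\{-1,1\}^n)}.$$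
   Context: Write $[n]=\{1,\dots,n\}$. The Hamming cube $\{-1,1\}^n$ carries the uniform probability measure, and for $p\in[1,\infty)$ and $f\colon\{-1,1\}^n\to\mathbb{C}$, $\|f\|_{L^p(\{-1,1\}^n)}=\left(2^{-n}\sum_{\delta\in\{-1,1\}^n}|f(\delta)|^p\right)^{1/p}$. For $S\subseteq[n]$ the Walsh function is $w_S(\delta)=\prod_{j\in S}\delta_j$, and each $f\colon\{-1,1\}^n\to\mathbb{C}$ has the Fourier--Walsh expansion $f=\sum_{S\subseteq[n]}\widehat f(S)w_S$ with $\widehat f(S)=2^{-n}\sum_{\delta}f(\delta)w_S(\delta)$. $\mathrm{Tail}_{\ge d}$ is the space of functions $f\colon\{-1,1\}^n\to\mathbb{C}$ with $\widehat f(S)=0$ whenever $|S|<d$. The Hamming cube Laplacian is $\Delta f=\sum_{j=1}^n\partial_j f$, where $\partial_j f(\delta)=\frac{f(\delta_1,\dots,\delta_j,\dots,\delta_n)-f(\delta_1,\dots,-\delta_j,\dots,\delta_n)}{2}$; equivalently $\Delta f=\sum_{S\subseteq[n]}|S|\,\widehat f(S)\,w_S$. The heat semigroup is $e^{-t\Delta}f=\sum_{S\subseteq[n]}e^{-t|S|}\,\widehat f(S)\,w_S$. The exponent $p_\varepsilon$ is defined by $p_\varepsilon=p+\varepsilon$ if $p\ge2$ and $\varepsilon>0$, and $p_\varepsilon=p-\varepsilon$ if $p\in(1,2)$ and $\varepsilon\in(0,p-1)$. *)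

(* Defs.v *)
From HB Require Import structures.
From mathcomp Require Import all_boot all_order all_algebra.
From mathcomp Require Import boolp classical_sets reals sequences exp.
From mathcomp Require Import complex.

Set Implicit Arguments.
Unset Strict Implicit.
Unset Printing Implicit Defensive.

Import Order.TTheory GRing.Theory Num.Theory.
Local Open Scope ring_scope.
Local Open Scope complex_scope.

(* A point of {-1,1}^n is encoded by its sign bits: the j-th coordinate of x is
   (-1) ^+ x j, so that true stands for -1 and false for 1. Coordinates are
   numbered from 0. *)
Definition cube (n : nat) := {ffun 'I_n -> bool}.

Definition coord (R : realType) (n : nat) (x : cube n) (j : 'I_n) : R[i] :=
  (-1) ^+ x j.

Definition flip (n : nat) (j : 'I_n) (x : cube n) : cube n :=
  [ffun k => (k == j) (+) x k].

Definition cfun (R : realType) (n : nat) := {ffun cube n -> R[i]}.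

Definition Lpnorm (R : realType) (n : nat) (p : R) (f : cfun R n) : R :=
  (2 ^- n * \sum_(x : cube n) Normc.normc (f x) `^ p) `^ p^-1.

Definition walsh (R : realType) (n : nat) (S : {set 'I_n}) : cfun R n :=
  [ffun x => \prod_(j in S) coord R x j].

Definition fourier (R : realType) (n : nat) (f : cfun R n) (S : {set 'I_n}) :
    R[i] :=
  2 ^- n * \sum_(x : cube n) f x * walsh R S x.

Definition tail (R : realType) (n d : nat) (f : cfun R n) : Prop :=
  forall S : {set 'I_n}, (#|S| < d)%N -> fourier f S = 0.

Definition partial (R : realType) (n : nat) (j : 'I_n) (f : cfun R n) :
    cfun R n :=
  [ffun x => (f x - f (flip j x)) / 2].

Definition laplacian (R : realType) (n : nat) (f : cfun R n) : cfun R n :=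
  \sum_(j < n) partial j f.

(* The operator exp (- t * laplacian), given spectrally: walsh_expansion and
   laplacian_walsh show that the laplacian is diagonal in the Walsh basis, with
   eigenvalue #|S| on walsh R S. *)
Definition heat (R : realType) (n : nat) (t : R) (f : cfun R n) : cfun R n :=
  [ffun x => \sum_(S : {set 'I_n})
     (expR (- t * #|S|%:R))%:C * fourier f S * walsh R S x].

(* Only meant for 1 < p and 0 < e, with e < p - 1 when p < 2. *)
Definition p_eps (R : realType) (p e : R) : R :=
  if 2 <= p then p + e else p - e.

Lemma walsh_expansion (R : realType) (n : nat) (f : cfun R n) (x : cube n) :
  f x = \sum_(S : {set 'I_n}) fourier f S * walsh R S x.
Proof.
have key (y : cube n) :
    \sum_(S : {set 'I_n}) walsh R S y * walsh R S x = (y == x)%:R * 2 ^+ n.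
  transitivity (\prod_(j < n) (coord R y j * coord R x j + 1)).
    rewrite bigA_distr; apply: eq_bigr => S _.
    rewrite !ffunE -big_split /= [RHS](bigID (mem S)) /=.
    rewrite [X in _ = _ * X]big1 ?mulr1; last by move=> j /negbTE ->.
    by apply: eq_bigr => j ->.
  have [->|neq] := eqVneq y x.
    rewrite mul1r (eq_bigr (fun=> 2)) ?prodr_const ?card_ord // => j _.
    by rewrite -expr2 /coord sqrr_sign.
  have [j yx] : exists j, y j != x j.
    apply/existsP; rewrite -negb_forall; apply: contra neq => /forallP e.
    by apply/eqP/ffunP => j; apply/eqP.
  rewrite (bigD1 j) //= /coord; case: (y j) (x j) yx => [] [] //= _;
  by rewrite ?(expr0, expr1, mul1r, mulr1) addNr !mul0r.
rewrite (eq_bigr (fun S => \sum_y 2 ^- n * f y * (walsh R S y * walsh R S x))).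
  rewrite exchange_big (bigD1 x) //= -mulr_sumr key eqxx mul1r.
  rewrite big1 ?addr0 => [|y /negbTE yx]; last first.
    by rewrite -mulr_sumr key yx mul0r mulr0.
  by rewrite mulrAC mulVf ?mul1r // expf_neq0 // pnatr_eq0.
by move=> S _; rewrite /fourier -mulrA mulr_suml mulr_sumr;
  apply: eq_bigr => y _; rewrite !mulrA.
Qed.

Lemma laplacian_walsh (R : realType) (n : nat) (S : {set 'I_n}) (x : cube n) :
  laplacian (walsh R S) x = #|S|%:R * walsh R S x.
Proof.
rewrite sum_ffunE -sum1_card natr_sum mulr_suml [RHS]big_mkcond /=.
apply: eq_bigr => j _; rewrite !ffunE; case: ifPn => jS; last first.
  have -> : \prod_(k in S) coord R (flip j x) k = \prod_(k in S) coord R x k.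
    apply: eq_bigr => k kS; rewrite /coord ffunE; case: eqVneq => // kj.
    by rewrite -kj kS in jS.
  by rewrite subrr mul0r.
have -> : \prod_(k in S) coord R (flip j x) k = - \prod_(k in S) coord R x k.
  rewrite (bigD1 j jS) [in RHS](bigD1 j jS) /= -mulNr; congr (_ * _).
    by rewrite /coord ffunE eqxx; case: (x j); rewrite ?opprK.
  by apply: eq_bigr => k /andP[_ /negbTE kj]; rewrite /coord ffunE kj.
by rewrite opprK -mulr2n -(mulr_natr (\prod_(k in S) _)) mulfK ?mul1r ?pnatr_eq0.
Qed.

(* Main.v *)
(* By Hoelder, Lp norms interpolate between L2 and L^(p_eps). On L2 the tail
   condition gives the decay exp(-td) by Parseval, while on L^(p_eps) the
   semigroup is a contraction, being an average against a symmetric probability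
   kernel; hence c = 1 - theta. Since theta depends only on p and p_eps, so does
   c, and (ii) follows from (i) because L2 norms are at most L^(p+eps) norms. *)

Require Import Defs.
From HB Require Import structures.
From mathcomp Require Import all_boot all_order all_algebra.
From mathcomp Require Import boolp classical_sets reals sequences exp.
From mathcomp Require Import complex.
From mathcomp Require Import ring lra.
Set Implicit Arguments.
Unset Strict Implicit.
Unset Printing Implicit Defensive.

Import Order.TTheory GRing.Theory Num.Theory.
Local Open Scope ring_scope.

(** * Hoelder and Jensen inequalities for finite sums *)

Lemma weighted_amgm (R : realType) (a b alpha beta : R) :
  0 <= a -> 0 <= b -> 0 < alpha -> 0 < beta -> alpha + beta = 1 ->
  a `^ alpha * b `^ beta <= alpha * a + beta * b.
Proof.
move=> a0 b0 al0 be0 ab1.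
(* Young's inequality with conjugate exponents 1/alpha and 1/beta. *)
have := @conjugate_powR R (a `^ alpha) (b `^ beta) alpha^-1 beta^-1
  (powR_ge0 _ _) (powR_ge0 _ _).
rewrite !invr_gt0 !invrK -!powRrM !mulfV ?gt_eqF // !powRr1 //.
by rewrite (mulrC a) (mulrC b); apply.
Qed.

Lemma hoelder_sum (R : realType) (I : finType) (a b : I -> R) (alpha beta : R) :
  (forall i, 0 <= a i) -> (forall i, 0 <= b i) ->
  0 <= alpha -> 0 <= beta -> alpha + beta = 1 ->
  \sum_i a i `^ alpha * b i `^ beta <=
    (\sum_i a i) `^ alpha * (\sum_i b i) `^ beta.
Proof.
move=> a0 b0; rewrite le_eqVlt => /predU1P[<- _|al0].
  rewrite add0r => ->; under eq_bigr do rewrite powRr0 mul1r powRr1 //.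
  by rewrite powRr0 mul1r powRr1 // sumr_ge0.
rewrite le_eqVlt => /predU1P[<-|be0].
  rewrite addr0 => ->; under eq_bigr do rewrite powRr0 mulr1 powRr1 //.
  by rewrite powRr0 mulr1 powRr1 // sumr_ge0.
move=> ab1; set A := \sum_i a i; set B := \sum_i b i.
have A0 : 0 <= A by apply: sumr_ge0.
have B0 : 0 <= B by apply: sumr_ge0.
have zero (c : I -> R) : (forall i, 0 <= c i) -> \sum_i c i = 0 ->
    forall i, c i = 0.
  move=> c0 /eqP; rewrite psumr_eq0 // => /allP + i.
  by move/(_ i (mem_index_enum i))/eqP.
have [A_eq0|A_neq0] := eqVneq A 0.
  rewrite big1 ?mulr_ge0 ?powR_ge0 // => i _.
  by rewrite (zero _ a0 A_eq0) powR0 ?gt_eqF // mul0r.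
have [B_eq0|B_neq0] := eqVneq B 0.
  rewrite big1 ?mulr_ge0 ?powR_ge0 // => i _.
  by rewrite (zero _ b0 B_eq0) powR0 ?gt_eqF // mulr0.
have norm i : a i `^ alpha * b i `^ beta =
    A `^ alpha * B `^ beta * ((a i / A) `^ alpha * (b i / B) `^ beta).
  rewrite mulrACA -!powRM ?divr_ge0 //.
  by rewrite !(mulrC _ (_ / _)) !divfK.
rewrite (eq_bigr _ (fun i _ => norm i)) -mulr_sumr ler_piMr ?mulr_ge0 ?powR_ge0 //.
rewrite (le_trans (y := \sum_i (alpha * (a i / A) + beta * (b i / B)))) //.
  by apply: ler_sum => i _; apply: weighted_amgm; rewrite ?divr_ge0.
by rewrite big_split /= -!mulr_sumr -!mulr_suml !mulfV // !mulr1 ab1.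
Qed.

(** This is Hoelder for the families w u and w, since w u^alpha = (w u)^alpha w^(1 - alpha) and the
    weights sum to 1. *)
Lemma jensen_powR (R : realType) (I : finType) (w u : I -> R) (alpha : R) :
  (forall i, 0 <= w i) -> \sum_i w i = 1 -> (forall i, 0 <= u i) ->
  0 <= alpha <= 1 ->
  \sum_i w i * u i `^ alpha <= (\sum_i w i * u i) `^ alpha.
Proof.
move=> w0 w1 u0 /andP[al0 al1].
have := @hoelder_sum R I (fun i => w i * u i) w alpha (1 - alpha).
rewrite w1 powR1 mulr1 => H.
apply: le_trans (H _ _ _ _ _) => //; last 3 first.
- by move=> i; rewrite mulr_ge0.
- by rewrite subr_ge0.
- by rewrite addrC subrK.
apply: ler_sum => i _; rewrite powRM // mulrAC -powRD.
  by rewrite addrC subrK powRr1.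
by rewrite addrC subrK oner_eq0.
Qed.

(** * Interpolation and monotonicity of the Lp norms *)

Lemma normc_ge0 (R : rcfType) (z : R[i]) : 0 <= Normc.normc z.
Proof. by case: z => a b; apply: sqrtr_ge0. Qed.

Lemma normc_real (R : rcfType) (a : R) : Normc.normc a%:C%C = `|a|.
Proof. by rewrite /Normc.normc /= expr0n addr0 sqrtr_sqr. Qed.

Lemma normc_sum (R : rcfType) (I : finType) (F : I -> R[i]) :
  Normc.normc (\sum_i F i) <= \sum_i Normc.normc (F i).
Proof.
elim/big_ind2: _ => [|z1 x1 z2 x2 le1 le2|//]; first by rewrite Normc.normc0.
by apply: le_trans (lerD le1 le2); apply: le_normcD.
Qed.

(** Hoelder for |f|^q0 and |f|^q1 with weights p (1 - theta) / q0 and p theta / q1, which sum to 1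
    by the relation between the exponents. The factor 2^-n is moved inside the sums, so that it
    splits by the same weights. *)
Lemma Lpnorm_interpolation (R : realType) (n : nat) (f : cfun R n)
    (p q0 q1 theta : R) :
  0 < p -> 0 < q0 -> 0 < q1 -> 0 <= theta <= 1 ->
  p^-1 = theta / q1 + (1 - theta) / q0 ->
  Lpnorm p f <= Lpnorm q0 f `^ (1 - theta) * Lpnorm q1 f `^ theta.
Proof.
move=> p0 q00 q10 /andP[th0 th1] pE.
rewrite /Lpnorm -[X in _ <= X * _]powRrM -[X in _ <= _ * X]powRrM !mulr_sumr.
have c0 : 0 <= 2 ^- n :> R by rewrite invr_ge0 exprn_ge0.
have ge0 q (x : cube n) : 0 <= 2 ^- n * Normc.normc (f x) `^ q.
  by rewrite mulr_ge0 // powR_ge0.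
have c1 : p * ((1 - theta) / q0) + p * (theta / q1) = 1.
  by rewrite -mulrDr addrC -pE mulfV ?gt_eqF.
(* A common outer exponent 1/p is factored out on the right, so that monotonicity of the p-th root
   removes it from both sides. *)
rewrite (_ : q0^-1 * _ = p * ((1 - theta) / q0) * p^-1);
  last by field; rewrite !gt_eqF.
rewrite (_ : q1^-1 * _ = p * (theta / q1) * p^-1);
  last by field; rewrite !gt_eqF.
rewrite (powRrM _ (p * ((1 - theta) / q0))) (powRrM _ (p * (theta / q1))).
rewrite -powRM ?powR_ge0 // ge0_ler_powR ?invr_ge0 ?(ltW p0) //.
- by rewrite nnegrE sumr_ge0.
- by rewrite nnegrE mulr_ge0 // powR_ge0.
apply: le_trans (hoelder_sum (ge0 q0) (ge0 q1) _ _ c1); last 2 first.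
- by rewrite mulr_ge0 ?(ltW p0) // divr_ge0 ?(ltW q00) // subr_ge0.
- by rewrite mulr_ge0 ?(ltW p0) // divr_ge0 ?(ltW q10).
apply: ler_sum => x _; rewrite !powRM ?powR_ge0 // mulrACA -powRD; last first.
  by rewrite c1 oner_eq0.
have qE : q0 * (p * ((1 - theta) / q0)) + q1 * (p * (theta / q1)) = p.
  by field; rewrite !gt_eqF.
by rewrite c1 powRr1 // -!powRrM -powRD qE // gt_eqF.
Qed.

Lemma Lpnorm_ge0 (R : realType) (n : nat) (p : R) (f : cfun R n) :
  0 <= Lpnorm p f.
Proof. exact: powR_ge0. Qed.

Lemma card_cube n : #|{: cube n}| = (2 ^ n)%N.
Proof. by rewrite card_ffun card_bool card_ord. Qed.

(** Jensen for the uniform probability, with the exponent p/q <= 1 applied to |f|^q. *)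
Lemma Lpnorm_le (R : realType) (n : nat) (f : cfun R n) (p q : R) :
  0 < p -> p <= q -> Lpnorm p f <= Lpnorm q f.
Proof.
move=> p0 pq; have q0 := lt_le_trans p0 pq.
have c0 : 0 <= 2 ^- n :> R by rewrite invr_ge0 exprn_ge0.
rewrite /Lpnorm (_ : q^-1 = p / q * p^-1); last by field; rewrite !gt_eqF.
rewrite powRrM ge0_ler_powR ?invr_ge0 ?(ltW p0) // ?nnegrE ?powR_ge0 //.
  by rewrite mulr_ge0 // sumr_ge0 // => x _; rewrite powR_ge0.
rewrite !mulr_sumr.
have pE : p = q * (p / q) by rewrite mulrC divfK ?gt_eqF.
under eq_bigr => x _ do rewrite [in X in _ * X]pE powRrM.
apply: (@jensen_powR _ _ (fun=> 2 ^- n) (fun x => Normc.normc (f x) `^ q)) => //.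
- rewrite sumr_const card_cube -[_ *+ (2 ^ n)]mulr_natr natrX mulVf //.
  by rewrite expf_neq0 // pnatr_eq0.
- by move=> x; rewrite powR_ge0.
- by rewrite divr_ge0 ?(ltW p0) ?(ltW q0) //= ler_pdivrMr // mul1r.
Qed.

(** * The heat kernel and contractivity of the semigroup *)

Definition heat_kernel (R : realType) (n : nat) (t : R) (x y : cube n) : R :=
  \prod_(j < n) ((1 + expR (- t) * (-1) ^+ (x j (+) y j)) / 2).

(** Together with [heat_kernel_sum], this makes the kernel a transition probability: each coordinate
    flips independently with probability (1 - e^-t) / 2. *)
Lemma heat_kernel_ge0 (R : realType) (n : nat) (t : R) (x y : cube n) :
  0 <= t -> 0 <= heat_kernel t x y.
Proof.
move=> t0; apply: prodr_ge0 => j _; rewrite divr_ge0 //.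
have : expR (- t) <= 1 by rewrite expR_le1 oppr_le0.
have := expR_ge0 (- t).
by case: (_ (+) _); rewrite ?expr1 ?expr0; lra.
Qed.

Lemma heat_kernelC (R : realType) (n : nat) (t : R) (x y : cube n) :
  heat_kernel t x y = heat_kernel t y x.
Proof. by apply: eq_bigr => j _; rewrite addbC. Qed.

Lemma heat_kernel_sum (R : realType) (n : nat) (t : R) (x : cube n) :
  \sum_(y : cube n) heat_kernel t x y = 1.
Proof.
rewrite -(bigA_distr_bigA
  (fun j b => (1 + expR (- t) * (-1) ^+ (x j (+) b)) / 2)) big1 // => j _.
by rewrite big_bool; case: (x j); rewrite /= ?expr1 ?expr0; field.
Qed.

(** Expanding the product means choosing e^-t x_j y_j or 1 at each coordinate j; the set S of
    coordinates where the first is chosen contributes e^(-t|S|) w_S(x) w_S(y). *)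
Lemma heat_kernel_walsh (R : realType) (n : nat) (t : R) (x y : cube n) :
  (heat_kernel t x y)%:C%C =
  2 ^- n * \sum_(S : {set 'I_n})
    (expR (- t * #|S|%:R))%:C%C * walsh R S x * walsh R S y.
Proof.
rewrite /heat_kernel rmorph_prod.
transitivity (\prod_(j < n) 
  (2^-1 * ((expR (- t))%:C%C * Defs.coord R x j * Defs.coord R y j + 1))).
  apply: eq_bigr => j _.
  rewrite /Defs.coord -mulrA -signr_addb.
  rewrite rmorphM rmorphD rmorph1 rmorphM rmorph_sign fmorphV rmorph_nat.
  by rewrite mulrC addrC.
rewrite big_split /= prodr_const card_ord exprVn bigA_distr; congr (_ * _).
apply: eq_bigr => S _.
rewrite !ffunE expRM_natr rmorphXn /= -prodr_const -!big_split /=.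
rewrite [LHS](bigID (mem S)) /=.
rewrite [X in _ * X]big1 ?mulr1; last by move=> j /negbTE ->.
by apply: eq_bigr => j ->.
Qed.

Lemma heat_kernelE (R : realType) (n : nat) (t : R) (f : cfun R n) (x : cube n) :
  heat t f x = \sum_(y : cube n) (heat_kernel t x y)%:C%C * f y.
Proof.
rewrite ffunE /fourier.
under [RHS]eq_bigr => y _ do rewrite heat_kernel_walsh mulr_sumr mulr_suml.
rewrite exchange_big /=; apply: eq_bigr => S _.
by rewrite 2!mulr_sumr mulr_suml; apply: eq_bigr => y _; ring.
Qed.

Lemma Lpnorm_heat_le (R : realType) (n : nat) (t q : R) (f : cfun R n) :
  0 <= t -> 1 <= q -> Lpnorm q (heat t f) <= Lpnorm q f.
Proof.
move=> t0 q1; have q0 : 0 < q by apply: lt_le_trans q1.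
have K0 (x y : cube n) := heat_kernel_ge0 x y t0.
have c0 : 0 <= 2 ^- n :> R by rewrite invr_ge0 exprn_ge0.
rewrite ge0_ler_powR ?invr_ge0 ?(ltW q0) ?nnegrE //.
- by rewrite mulr_ge0 // sumr_ge0 // => x _; rewrite powR_ge0.
- by rewrite mulr_ge0 // sumr_ge0 // => x _; rewrite powR_ge0.
rewrite ler_wpM2l //.
apply: (@le_trans _ _ (\sum_(x : cube n) \sum_(y : cube n)
    heat_kernel t x y * Normc.normc (f y) `^ q)); last first.
  (* By symmetry the kernel also has total mass 1 in its first argument. *)
  rewrite exchange_big /=; apply: ler_sum => y _; rewrite -mulr_suml.
  under eq_bigr => x _ do rewrite heat_kernelC.
  by rewrite heat_kernel_sum mul1r.
apply: ler_sum => x _.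
(* Convexity of the q-th power is used in its concave form: Jensen with exponent 1/q applied to
   |f|^q. *)
have /(ge0_ler_powR (ltW q0)) H : Normc.normc (heat t f x) <=
    (\sum_(y : cube n) heat_kernel t x y * Normc.normc (f y) `^ q) `^ q^-1.
  rewrite heat_kernelE; apply: le_trans (normc_sum _) _.
  apply: le_trans (jensen_powR (u := fun y => Normc.normc (f y) `^ q)
    (K0 x) (heat_kernel_sum t x) _ _); last 2 first.
  - by move=> y; rewrite powR_ge0.
  - by rewrite invr_ge0 (ltW q0) invf_le1.
  apply: ler_sum => y _; rewrite Normc.normcM -powRrM mulfV ?gt_eqF //.
  by rewrite powRr1 ?normc_ge0 // ler_wpM2r ?normc_ge0 // normc_real ger0_norm.
apply: le_trans (H _ _) _; rewrite ?nnegrE ?normc_ge0 ?powR_ge0 //.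
rewrite -powRrM mulVf ?gt_eqF // powRr1 // sumr_ge0 // => y _.
by rewrite mulr_ge0 ?powR_ge0.
Qed.

(** * Orthogonality, Parseval and decay in L2 *)

Lemma walsh_orthogonal (R : realType) (n : nat) (S T : {set 'I_n}) :
  \sum_(x : cube n) walsh R S x * walsh R T x = (S == T)%:R * 2 ^+ n.
Proof.
pose g (U : {set 'I_n}) (j : 'I_n) (b : bool) : R[i]%C :=
  if j \in U then (-1) ^+ b else 1.
(* The sum over the cube factors into coordinates; a coordinate lying in exactly one of S and T
   gives the factor -1 + 1 = 0. *)
transitivity (\prod_(j < n) \sum_b g S j b * g T j b).
  rewrite bigA_distr_bigA; apply: eq_bigr => x _.
  by rewrite !ffunE big_split; congr (_ * _); rewrite big_mkcond.
have [->|neq] := eqVneq S T.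
  rewrite mul1r (eq_bigr (fun=> 2)) ?prodr_const ?card_ord // => j _.
  by rewrite big_bool /g; case: ifP => _; rewrite ?expr1 ?expr0 ?mulrNN !mulr1.
have [j jST] : exists j, (j \in S) != (j \in T).
  apply/existsP; rewrite -negb_forall; apply: contra neq => /forallP e.
  by apply/eqP/setP => j; apply/eqP.
rewrite (bigD1 j) //= big_bool /g; case: (j \in S) (j \in T) jST => [] [] //= _;
by rewrite ?(expr0, expr1, mul1r, mulr1) addNr !mul0r.
Qed.

Lemma walsh_conj (R : realType) (n : nat) (S : {set 'I_n}) (x : cube n) :
  (walsh R S x)^* = walsh R S x.
Proof. by rewrite ffunE rmorph_prod; apply: eq_bigr => j _; rewrite rmorph_sign. Qed.

(** The coefficients [a] are arbitrary, so that the lemma applies to [heat t f] directly from its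
    spectral definition. Orthogonality removes the off-diagonal terms of g times its conjugate. *)
Lemma parseval (R : realType) (n : nat) (g : cfun R n) (a : {set 'I_n} -> R[i]%C) :
  (forall x, g x = \sum_(S : {set 'I_n}) a S * walsh R S x) ->
  2 ^- n * \sum_(x : cube n) Normc.normc (g x) ^+ 2 =
  \sum_(S : {set 'I_n}) Normc.normc (a S) ^+ 2.
Proof.
move=> gE; apply: (@complexI R); rewrite rmorphM fmorphV rmorphXn rmorph_nat.
rewrite !rmorph_sum /=.
under eq_bigr => x _ do rewrite rmorphXn /=.
under [RHS]eq_bigr => S _ do rewrite rmorphXn /=.
have nE (z : R[i]%C) : (Normc.normc z)%:C%C = `|z| by [].
under eq_bigr => x _ do rewrite nE normCK gE rmorph_sum mulr_suml.
under eq_bigr => x _ do under eq_bigr => S _ do rewrite mulr_sumr.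
rewrite exchange_big mulr_sumr /=; apply: eq_bigr => S _.
rewrite exchange_big (bigD1 S) //= [X in _ + X]big1 => [|T TS].
  have -> : \sum_(x : cube n) a S * walsh R S x * (a S * walsh R S x)^* =
      `|a S| ^+ 2 * 2 ^+ n.
    have /esym := walsh_orthogonal R S S; rewrite eqxx mul1r => ->.
    rewrite mulr_sumr.
    by apply: eq_bigr => x _; rewrite rmorphM /= walsh_conj normCK; ring.
  by rewrite addr0 mulrC mulfK // expf_neq0 // pnatr_eq0.
transitivity (a S * (a T)^* * \sum_(x : cube n) walsh R S x * walsh R T x).
  rewrite mulr_sumr; apply: eq_bigr => x _.
  by rewrite rmorphM /= walsh_conj; ring.
by rewrite walsh_orthogonal eq_sym (negbTE TS) mul0r mulr0.
Qed.

Lemma Lpnorm2_heat_le (R : realType) (n d : nat) (t : R) (f : cfun R n) :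
  tail d f -> 0 <= t ->
  Lpnorm 2 (heat t f) <= expR (- t * d%:R) * Lpnorm 2 f.
Proof.
move=> tailf t0.
have LE (g : cfun R n) :
    Lpnorm 2 g = (2 ^- n * \sum_(x : cube n) Normc.normc (g x) ^+ 2) `^ 2^-1.
  by congr ((_ * _) `^ _); apply: eq_bigr => x _; rewrite powR_mulrn ?normc_ge0.
have sum_ge0 (a : {set 'I_n} -> R[i]%C) :
    0 <= \sum_(S : {set 'I_n}) Normc.normc (a S) ^+ 2.
  by apply: sumr_ge0 => S _; rewrite sqr_ge0.
rewrite !LE (parseval (walsh_expansion f)).
rewrite (parseval (g := heat t f)
  (a := fun S => (expR (- t * #|S|%:R))%:C%C * fourier f S)); last first.
  by move=> x; rewrite ffunE.
have sqrtE (a : R) : 0 <= a -> a = (a ^+ 2) `^ 2^-1.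
  by move=> a0; rewrite -powR_mulrn // -powRrM mulfV ?powRr1 // pnatr_eq0.
(* The decay factor is moved under the square root, so that the squared coefficients can be compared
   one by one. *)
rewrite [X in X * _]sqrtE ?expR_ge0 // -powRM ?exprn_ge0 ?expR_ge0 //.
apply: ge0_ler_powR; rewrite ?nnegrE ?invr_ge0 ?mulr_ge0 ?exprn_ge0 ?expR_ge0 //.
rewrite mulr_sumr; apply: ler_sum => S _.
rewrite Normc.normcM exprMn.
have -> : Normc.normc (expR (- t * #|S|%:R))%:C%C = expR (- t * #|S|%:R) :> R.
  by rewrite normc_real ger0_norm ?expR_ge0.
have [Sd|dS] := ltnP #|S| d.
  by rewrite tailf // Normc.normc0 expr0n !mulr0.
rewrite ler_wpM2r ?sqr_ge0 // lerXn2r ?nnegrE ?expR_ge0 // ler_expR.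
by rewrite !mulNr lerN2 ler_wpM2l // ler_nat.
Qed.

(** * Interpolated decay and the choice of the constant *)

Lemma Lpnorm_heat_interpolation (R : realType) (n d : nat) (p q theta t : R)
    (f : cfun R n) :
  0 < p -> 1 <= q -> 0 <= theta <= 1 ->
  p^-1 = theta / q + (1 - theta) / 2 ->
  tail d f -> 0 <= t ->
  Lpnorm p (heat t f) <= expR (- (1 - theta) * t * d%:R) *
    (Lpnorm 2 f `^ (1 - theta) * Lpnorm q f `^ theta).
Proof.
move=> p0 q1 th pE tailf t0; have /andP[th0 th1] := th.
have q0 : 0 < q by apply: lt_le_trans q1.
apply: le_trans (Lpnorm_interpolation _ p0 _ q0 th pE) _ => //.
(* Only the L2 factor decays, and it enters with the power 1 - theta. *)
have -> : expR (- (1 - theta) * t * d%:R) = expR (- t * d%:R) `^ (1 - theta).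
  by rewrite -expRM; congr expR; ring.
have decay := Lpnorm2_heat_le tailf t0.
have contr := Lpnorm_heat_le f t0 q1.
have := Lpnorm_ge0 2 (heat t f); have := Lpnorm_ge0 q (heat t f).
have := Lpnorm_ge0 2 f; have := expR_ge0 (- t * d%:R).
move: (Lpnorm 2 _) (Lpnorm q _) (Lpnorm 2 f) (Lpnorm q f) (expR _) decay contr.
move=> h2 hq f2 fq e decay contr e0 f20 hq0 h20.
rewrite mulrA -powRM // ler_pM ?powR_ge0 // ge0_ler_powR ?nnegrE ?subr_ge0 //.
- by rewrite mulr_ge0.
- exact: le_trans contr.
Qed.

(** The relation is affine in theta, with solution (1/2 - 1/p) / (1/2 - 1/p_eps). As 1/p lies
    between 1/2 and 1/p_eps and differs from the latter, the solution is in [0, 1), being 0 at p =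
    2. Its being below 1 makes the decay rate positive. *)
Lemma interpolation_parameter (R : realType) (p eps : R) :
  1 < p -> 0 < eps -> (p < 2 -> eps < p - 1) ->
  exists2 theta0 : R, 0 <= theta0 < 1 &
    forall theta, p^-1 = theta / p_eps p eps + (1 - theta) / 2 <->
      theta = theta0.
Proof.
move=> p1 e0 pe; have p0 : 0 < p by lra.
set q := p_eps p eps.
have [q0 uv] : 0 < q /\
    (q^-1 < p^-1 /\ p^-1 <= 2^-1 \/ 2^-1 < p^-1 /\ p^-1 < q^-1).
  rewrite /q /p_eps; case: (leP 2 p) => p2; split; try lra.
  - by left; rewrite ltf_pV2 ?lef_pV2 ?posrE //; lra.
  - by have := pe p2; right; rewrite !ltf_pV2 ?posrE //; lra.
move: (p^-1) (q^-1) uv => u v uv.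
have D : 2^-1 - v != 0 by apply/eqP; lra.
exists ((2^-1 - u) / (2^-1 - v)).
  case: uv => -[uv1 uv2].
    by rewrite divr_ge0 ?ltr_pdivrMr //; lra.
  (* For p < 2 numerator and denominator are both negative, so both signs are changed. *)
  by rewrite -mulrNN -invrN divr_ge0 ?ltr_pdivrMr //; lra.
move=> theta; split=> [uE|->].
  apply: (mulIf D); rewrite divfK // uE; ring.
by field; apply: contra D => /eqP h; apply/eqP; lra.
Qed.

Theorem proposition1p8 :
  forall (R : realType) (p eps : R),
    1 < p -> 0 < eps -> (p < 2 -> eps < p - 1) ->
  exists c : R, 0 < c /\
    forall (n d : nat) (f : cfun R n) (t : R),
      (0 < n)%N -> (1 <= d <= n)%N -> tail d f -> 0 < t ->
      (forall theta : R,
         p^-1 = theta / p_eps p eps + (1 - theta) / 2 ->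
         Lpnorm p (heat t f) <=
           expR (- c * t * d%:R) *
           (Lpnorm 2 f `^ (1 - theta) * Lpnorm (p_eps p eps) f `^ theta)) /\
      (2 <= p ->
         Lpnorm p (heat t f) <= expR (- c * t * d%:R) * Lpnorm (p + eps) f).
Proof.
move=> R p eps p1 e0 pe; have p0 : 0 < p by lra.
have [theta0 /andP[th0 th1] thP] := interpolation_parameter p1 e0 pe.
have q1 : 1 <= p_eps p eps.
  by rewrite /p_eps; case: (leP 2 p) => [|/pe]; lra.
have th : 0 <= theta0 <= 1 by rewrite th0 ltW.
have pE := (thP theta0).2 erefl.
exists (1 - theta0); rewrite subr_gt0; split=> // n d f t _ _ tailf /ltW t0.
have main := Lpnorm_heat_interpolation p0 q1 th pE tailf t0.
(* Any admissible theta equals [theta0], so a constant fixed beforehand serves for all. *)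
split=> [theta /thP ->|p2] //.
apply: le_trans main _; rewrite ler_wpM2l ?expR_ge0 // {q1 pE}/p_eps p2.
have : Lpnorm 2 f <= Lpnorm (p + eps) f by apply: Lpnorm_le; lra.
have := Lpnorm_ge0 2 f; have := Lpnorm_ge0 (p + eps) f.
move: (Lpnorm 2 f) (Lpnorm (p + eps) f) => a b b0 a0 ab.
(* This also holds for b = 0, because the exponents sum to 1 and not to 0. *)
have bE : b = b `^ (1 - theta0) * b `^ theta0.
  by rewrite -powRD subrK ?powRr1 // oner_eq0.
rewrite [leRHS]bE ler_wpM2r ?powR_ge0 // ge0_ler_powR ?nnegrE //.
by rewrite subr_ge0 ltW.
Qed.
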